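(* Let $\hat A \in \mathbb{R}^{m\times n}$, $\hat b\in\mathbb{R}^m$, $\hat c\in\mathbb{R}^n$. Suppose that $\mathcal{U}\subseteq\mathbb{R}^m\times\mathbb{R}^n$ is compact and convex and contains $(0,0)$, and suppose that both feasible sets $P(0)$ and $D(0)$ are nonempty and that one of them is bounded. Then both $$q^+ := \sup\{p(b,c):(b,c)\in\overline{\mathcal{U}}\}\quad\text{and}\quad q^- := \inf\{p(b,c):(b,c)\in\overline{\mathcal{U}}\}$$ are finite.
   Context: For $(b,c)\in\mathcal{U}$, the perturbed optimal value is $p(b,c):=\min\{(\hat c+c)^Tx:\hat Ax=\hat b+b,\ x\ge0\}$, understood as an extended real number ($+\infty$ if infeasible, $-\infty$ if unbounded below). The perturbed primal and dual feasible sets are $P(b):=\{x\in\mathbb{R}^n:\hat Ax=\hat b+b,\ x\ge0\}$ and $D(c):=\{(y,s)\in\mathbb{R}^m\times\mathbb{R}^n:\hat A^Ty+s=\hat c+c,\ s\ge0\}$. The restricted uncertainty set is $\overline{\mathcal{U}}:=\{(b,c)\in\mathcal{U}:P(b)\neq\emptyset,\ D(c)\neq\emptyset\}$. *)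

(* Defs.v *)
From HB Require Import structures.
From mathcomp Require Import all_boot all_order all_algebra.
From mathcomp Require Import all_classical all_reals all_analysis.

Set Implicit Arguments.
Unset Strict Implicit.
Unset Printing Implicit Defensive.

Import Order.TTheory GRing.Theory Num.Theory.
Import numFieldNormedType.Exports.

Local Open Scope classical_set_scope.
Local Open Scope ring_scope.

Definition nonneg_vec (R : realType) (n : nat) (x : 'cV[R]_n) : Prop :=
  forall i : 'I_n, 0 <= x i 0.

Definition primal_feasible (R : realType) (m n : nat) (Ahat : 'M[R]_(m, n))
    (bhat b : 'cV[R]_m) : set 'cV[R]_n :=
  [set x | Ahat *m x = bhat + b /\ nonneg_vec x].

Definition dual_feasible (R : realType) (m n : nat) (Ahat : 'M[R]_(m, n))
    (chat c : 'cV[R]_n) : set ('cV[R]_m * 'cV[R]_n) :=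
  [set ys | Ahat^T *m ys.1 + ys.2 = chat + c /\ nonneg_vec ys.2].

(* The infimum in \bar R realises the conventions for the "min" of a linear
   program: it is +oo over an empty feasible set and -oo if the objective is
   unbounded below. *)
Definition optimal_value (R : realType) (m n : nat) (Ahat : 'M[R]_(m, n))
    (bhat : 'cV[R]_m) (chat : 'cV[R]_n) (b : 'cV[R]_m) (c : 'cV[R]_n) : \bar R :=
  ereal_inf [set (((chat + c)^T *m x) 0 0)%:E
            | x in primal_feasible Ahat bhat b].

Definition restricted_uncertainty (R : realType) (m n : nat)
    (Ahat : 'M[R]_(m, n)) (bhat : 'cV[R]_m) (chat : 'cV[R]_n)
    (U : set ('cV[R]_m * 'cV[R]_n)) : set ('cV[R]_m * 'cV[R]_n) :=
  [set bc | [/\ U bc, primal_feasible Ahat bhat bc.1 !=set0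
              & dual_feasible Ahat chat bc.2 !=set0]].

Definition worst_value (R : realType) (m n : nat) (Ahat : 'M[R]_(m, n))
    (bhat : 'cV[R]_m) (chat : 'cV[R]_n)
    (U : set ('cV[R]_m * 'cV[R]_n)) : \bar R :=
  ereal_sup [set optimal_value Ahat bhat chat bc.1 bc.2
            | bc in restricted_uncertainty Ahat bhat chat U].

Definition best_value (R : realType) (m n : nat) (Ahat : 'M[R]_(m, n))
    (bhat : 'cV[R]_m) (chat : 'cV[R]_n)
    (U : set ('cV[R]_m * 'cV[R]_n)) : \bar R :=
  ereal_inf [set optimal_value Ahat bhat chat bc.1 bc.2
            | bc in restricted_uncertainty Ahat bhat chat U].

(* Main.v *)
Require Import Defs.
From HB Require Import structures.
From mathcomp Require Import all_boot all_order all_algebra.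
From mathcomp Require Import all_classical all_reals all_analysis.
From mathcomp Require Import ring lra.

Set Implicit Arguments.
Unset Strict Implicit.
Unset Printing Implicit Defensive.

Import Order.TTheory GRing.Theory Num.Theory.
Import numFieldNormedType.Exports.

Local Open Scope classical_set_scope.
Local Open Scope ring_scope.

(** Every value p(b,c) over the restricted uncertainty set is pinched between
two constants. All the compactness that is needed follows from one fact: if
the only solution of the homogeneous system x B <= 0 is x = 0, then the sum of
the squared positive parts of the entries of x B (the penalty) dominates a
positive multiple of |x|^2, since it is homogeneous of degree 2, continuous
and positive on the compact unit sphere ([penalty_coercive]). A nonempty
bounded polyhedron has no nonzero recession direction ([bounded_recession]),
so a boundedness hypothesis on the unperturbed problem yields such a matrix B,
and B does not depend on the perturbation. The data bhat + b and chat + c stay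
bounded because U is compact ([data_bounded]).

If P(0) is bounded, the cone of all x >= 0 with A x = 0 is trivial; hence
all the sets P(b) lie in one ball ([trivial_cone_bounded]), on which the
objective is bounded ([primal_objective_bounded]).

If D(0) is bounded, the cone of all y with y A <= 0 is trivial, so all the
sets D(c) lie in one ball and weak duality gives the lower bound
([dual_bounded_lower]). For the upper bound it is enough to find in P(b) a
point of norm bounded uniformly in b. Coercivity makes the convex function
y |-> penalty y - 2 y b attain its minimum, at a point whose norm is
controlled by that of b; its gradient vanishes there, which says exactly that
the vector of positive parts of y A is a nonnegative solution x of A x = b
([trivial_cone_solvable]). This is Farkas' lemma with a bound on the solution;
strong duality is bypassed. *)

(** * Coercivity of the penalty of a homogeneous system *)

Definition pos_coord (R : realType) n p (B : 'M[R]_(n, p)) (x : 'rV[R]_n)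
    (j : 'I_p) : R :=
  Num.max 0 ((x *m B) 0 j).

(** The square makes this function differentiable: half its gradient at x is
[B] applied to the vector of the positive parts. *)
Definition penalty (R : realType) n p (B : 'M[R]_(n, p)) (x : 'rV[R]_n) : R :=
  \sum_j pos_coord B x j ^+ 2.

Definition trivial_cone (R : realType) n p (B : 'M[R]_(n, p)) : Prop :=
  forall x : 'rV[R]_n, (forall j, (x *m B) 0 j <= 0) -> x = 0.

Lemma pos_coord_ge0 (R : realType) n p (B : 'M[R]_(n, p)) x j :
  0 <= pos_coord B x j.
Proof. by rewrite /pos_coord le_max lexx. Qed.

Lemma penalty_ge0 (R : realType) n p (B : 'M[R]_(n, p)) x : 0 <= penalty B x.
Proof. by apply: sumr_ge0 => j _; rewrite sqr_ge0. Qed.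

Lemma penaltyZ (R : realType) n p (B : 'M[R]_(n, p)) (t : R) x :
  0 <= t -> penalty B (t *: x) = t ^+ 2 * penalty B x.
Proof.
move=> t0; rewrite /penalty mulr_sumr; apply: eq_bigr => j _.
rewrite -exprMn; congr (_ ^+ 2).
by rewrite /pos_coord -scalemxAl mxE maxr_pMr// mulr0.
Qed.

Lemma penalty_eq0 (R : realType) n p (B : 'M[R]_(n, p)) x :
  penalty B x = 0 -> forall j, (x *m B) 0 j <= 0.
Proof.
move=> /eqP; rewrite psumr_eq0; last by move=> j _; rewrite sqr_ge0.
move=> /allP h j; have := h j; rewrite mem_index_enum => /(_ isT) /=.
by rewrite sqrf_eq0 => /eqP <-; rewrite /pos_coord le_max lexx orbT.
Qed.

Lemma continuous_mulmx_coord (R : realType) n p (B : 'M[R]_(n, p)) j :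
  continuous (fun x : 'rV[R]_n => (x *m B) 0 j : R).
Proof.
have -> : (fun x : 'rV[R]_n => (x *m B) 0 j) =
          (fun x => \sum_k x 0 k * B k j) by apply/funext => x; rewrite mxE.
apply: continuous_big; first exact: add_continuous.
move=> i _ x; apply: continuousM; first exact: coord_continuous.
exact: cst_continuous.
Qed.

Lemma continuous_penalty (R : realType) n p (B : 'M[R]_(n, p)) :
  continuous (penalty B).
Proof.
rewrite /penalty; apply: continuous_big; first exact: add_continuous.
move=> j _ x.
have h : {for x, continuous (pos_coord B ^~ j)}.
  have /= := @continuous_max R 'rV[R]_n (cst 0) (fun x => (x *m B) 0 j) x.
  by apply; [exact: cst_continuous | exact: continuous_mulmx_coord].
exact: (continuousM h h).
Qed.

(** The constant k is the minimum of the penalty on the unit sphere, positive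
because the penalty vanishes only on the cone x B <= 0; homogeneity of degree
2 extends the bound to the whole space. *)
Lemma penalty_coercive (R : realType) n p (B : 'M[R]_(n, p)) :
  trivial_cone B ->
  exists2 k : R, 0 < k & forall x, k * `|x| ^+ 2 <= penalty B x.
Proof.
move=> B0.
have [[x0 x0N0]|all0] := pselect (exists x : 'rV[R]_n, x != 0); last first.
  (* In dimension 0 the unit sphere is empty and any constant works. *)
  exists 1 => // x; have [->|xN0] := eqVneq x 0.
    by rewrite normr0 expr0n mulr0 penalty_ge0.
  by exfalso; apply: all0; exists x.
have nrm1 (x : 'rV[R]_n) : x != 0 -> `| `|x|^-1 *: x | = 1.
  by move=> xN0; rewrite normrZ normfV normr_id mulVf// normr_eq0.
pose S := [set x : 'rV[R]_n | `|x| = 1].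
have S0 : S !=set0 by exists (`|x0|^-1 *: x0); exact: nrm1.
have Sc : compact S.
  apply: bounded_closed_compact.
    exists 1; split; first exact: num_real.
    by move=> M M1 x /= ->; exact: ltW.
  apply: (@preimage_closed _ _ (fun x : 'rV[R]_n => `|x|) [set x | x = 1]).
    by move=> x _; exact: norm_continuous.
  exact: closed_eq.
have [c cS cmin] := compact_EVT_min S0 Sc
  (continuous_subspaceT (@continuous_penalty _ _ _ B)).
exists (penalty B c).
  rewrite lt_neqAle penalty_ge0 andbT eq_sym; apply/eqP => /penalty_eq0/B0 c0.
  by move: cS; rewrite inE /S/= c0 normr0 => /esym/eqP; rewrite oner_eq0.
move=> x; have [->|xN0] := eqVneq x 0.
  by rewrite normr0 expr0n mulr0 penalty_ge0.
have := cmin (`|x|^-1 *: x); rewrite inE => /(_ (nrm1 _ xN0)).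
rewrite penaltyZ ?invr_ge0// exprVn => h.
by rewrite mulrC -ler_pdivlMl// exprn_gt0// normr_gt0.
Qed.

(** * Consequences of a trivial cone *)

(** A crude substitute for the square root of [c], accurate enough where only
the existence of a bound matters. *)
Lemma sqr_le_bound (R : realType) (x c : R) : 0 <= x -> x ^+ 2 <= c -> x <= 1 + c.
Proof. by move=> x0 xc; nra. Qed.

Lemma coord_le_norm (R : realType) m n (A : 'M[R]_(m, n)) i j : `|A i j| <= `|A|.
Proof.
rewrite [leRHS]/Num.norm/= mx_normrE.
exact: (le_bigmax _ (fun ij : 'I_m * 'I_n => `|A ij.1 ij.2|) (i, j)).
Qed.

Lemma norm_dot_le (R : realType) n (u : 'rV[R]_n) (v : 'cV[R]_n) (a b : R) :
  (forall i, `|u 0 i| <= a) -> (forall i, `|v i 0| <= b) ->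
  `|(u *m v) 0 0| <= n%:R * (a * b).
Proof.
move=> ua vb; rewrite mxE (le_trans (ler_norm_sum _ _ _))//.
rewrite (le_trans (ler_sum _ (_ : forall i, true -> _ <= a * b)))//.
  by move=> i _; rewrite normrM ler_pM.
by rewrite sumr_const card_ord mulr_natl.
Qed.

(** On the polyhedron the penalty is at most p t^2, so coercivity bounds the
norm. *)
Lemma trivial_cone_bounded (R : realType) n p (B : 'M[R]_(n, p)) (t : R) :
  trivial_cone B -> 0 <= t ->
  exists M : R, forall x : 'rV[R]_n, (forall j, (x *m B) 0 j <= t) -> `|x| <= M.
Proof.
move=> /penalty_coercive[k k0 kB] t0.
exists (1 + p%:R * t ^+ 2 / k) => x xt.
apply: sqr_le_bound => //; rewrite ler_pdivlMr// mulrC (le_trans (kB x))//.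
rewrite (le_trans (ler_sum _ (_ : forall j, true -> _ <= t ^+ 2)))//.
  move=> j _; rewrite ler_sqr ?nnegrE ?pos_coord_ge0//.
  by rewrite /pos_coord ge_max t0 xt.
by rewrite sumr_const card_ord mulr_natl.
Qed.

Lemma quadratic_ge0_linear_eq0 (R : realType) (l q : R) :
  0 <= q -> (forall t, 0 <= 2 * t * l + t ^+ 2 * q) -> l = 0.
Proof.
(* The minimiser - l / q of the quadratic, shifted to allow q = 0. *)
move=> q0 /(_ (- l / (q + 1))).
have q1 : q + 1 != 0 by lra.
rewrite (_ : _ + _ = - (l ^+ 2 * ((q + 2) / (q + 1) ^+ 2))); last by field.
rewrite oppr_ge0 pmulr_lle0 ?divr_gt0 ?exprn_gt0 //; [|lra|lra].
by move=> l2; apply/eqP; rewrite -sqrf_eq0 eq_le l2 sqr_ge0.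
Qed.

(** The first-order expansion of the penalty at y, with an explicit bound on the
remainder valid for all t because max(0, u + v) <= |max(0, u) + v|;
a global minimum can thus be exploited without derivatives. *)
Lemma penaltyD_le (R : realType) n p (B : 'M[R]_(n, p)) (y d : 'rV[R]_n) (t : R) :
  penalty B (y + t *: d) <=
  penalty B y + 2 * t * \sum_j pos_coord B y j * (d *m B) 0 j
  + t ^+ 2 * \sum_j (d *m B) 0 j ^+ 2.
Proof.
rewrite /penalty 2!mulr_sumr -!big_split/= ler_sum// => j _.
rewrite /pos_coord; set u : R := (y *m B) 0 j; set v : R := (d *m B) 0 j.
rewrite (_ : ((y + t *: d) *m B) 0 j = u + t * v); last first.
  by rewrite mulmxDl -scalemxAl mxE [X in _ + X]mxE.
rewrite [leRHS](_ : _ = (Num.max 0 u + t * v) ^+ 2); last by ring.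
case: (lerP 0 (u + t * v)) => h; last by rewrite expr0n sqr_ge0.
have : u + t * v <= Num.max 0 u + t * v by rewrite lerD2r le_max lexx orbT.
by move=> h2; rewrite ler_sqr ?nnegrE// (le_trans h).
Qed.

(** Farkas' lemma with a uniform bound. At a minimiser y of the coercive function
f y = penalty y - 2 y b, stationarity reads B x = b for the vector x of
the positive parts of y B; and f y <= f 0 = 0 bounds penalty y, hence x. *)
Lemma trivial_cone_solvable (R : realType) n p (B : 'M[R]_(n, p)) (beta : R) :
  trivial_cone B -> 0 <= beta ->
  exists M : R, forall b : 'cV[R]_n, (forall i, `|b i 0| <= beta) ->
    exists x : 'cV[R]_p, (forall j, 0 <= x j 0 <= M) /\ B *m x = b.
Proof.
move=> /penalty_coercive[k k0 kB] beta0.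
(* C |y| bounds the linear term of f, and rho = C / k is the radius beyond
   which k |y|^2 exceeds it, so that f is positive there. *)
pose C := 2 * n%:R * beta; pose rho := C / k.
have C0 : 0 <= C by rewrite !mulr_ge0// ler0n.
have rho0 : 0 <= rho by rewrite divr_ge0// ltW.
exists (1 + C * rho) => b bb.
pose f y := penalty B y - 2 * (y *m b) 0 0.
have dotC (y : 'rV[R]_n) : 2 * (y *m b) 0 0 <= C * `|y|.
  have := norm_dot_le (fun i => coord_le_norm y 0 i) bb.
  by move=> /ler_normlW; rewrite /C; lra.
have f0 : f 0 = 0.
  rewrite /f -(scale0r 0) penaltyZ// expr0n mul0r.
  by rewrite scale0r mul0mx mxE mulr0 subr0.
have fcont : continuous f.
  move=> y; apply: continuousB; first exact: continuous_penalty.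
  have /= := @continuousM R 'rV[R]_n (cst 2) (fun y => (y *m b) 0 0) y.
  by apply; [exact: cst_continuous | exact: continuous_mulmx_coord].
pose S := [set y : 'rV[R]_n | `|y| <= rho].
have Sc : compact S.
  apply: bounded_closed_compact.
    exists rho; split; first exact: num_real.
    by move=> M Mrho x /= xr; rewrite (le_trans xr)// ltW.
  apply: (@preimage_closed _ _ (fun x : 'rV[R]_n => `|x|) [set x | x <= rho]).
    by move=> x _; exact: norm_continuous.
  exact: closed_le.
have S0 : S 0 by rewrite /S/= normr0.
have [y yS ymin] := compact_EVT_min (ex_intro _ _ S0) Sc
  (continuous_subspaceT fcont).
have fy0 : f y <= 0 by rewrite -f0; apply: ymin; rewrite inE.
have gmin z : f y <= f z.
  have [zr|zr] := leP `|z| rho; first by apply: ymin; rewrite inE.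
  rewrite (le_trans fy0)// subr_ge0 (le_trans (dotC z))// (le_trans _ (kB z))//.
  have : C < `|z| * k by rewrite -ltr_pdivrMr.
  have := normr_ge0 z; nra.
exists (\col_j pos_coord B y j); split.
  move=> j; rewrite mxE pos_coord_ge0/=; apply: sqr_le_bound.
    exact: pos_coord_ge0.
  rewrite (@le_trans _ _ (penalty B y))//.
    by rewrite /penalty (bigD1 j)//= lerDl sumr_ge0// => i _; rewrite sqr_ge0.
  move: fy0; rewrite /f subr_le0 => /le_trans; apply.
  by rewrite (le_trans (dotC y))// ler_wpM2l//; move: yS; rewrite inE.
(* Stationarity of f at y in the i-th coordinate direction d. *)
apply/colP => i; apply/eqP; rewrite -subr_eq0; apply/eqP.
pose d : 'rV[R]_n := delta_mx 0 i.
have dE q (N : 'M[R]_(n, q)) j : (d *m N) 0 j = N i j by rewrite -rowE mxE.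
apply: (@quadratic_ge0_linear_eq0 _ _ (\sum_j (d *m B) 0 j ^+ 2)).
  by apply: sumr_ge0 => j _; rewrite sqr_ge0.
move=> t; have := gmin (y + t *: d).
move=> h; have := le_trans h (lerB (penaltyD_le B y d t) (lexx _)); clear h.
have -> : ((y + t *: d) *m b) 0 0 = (y *m b) 0 0 + t * b i 0.
  by rewrite mulmxDl -scalemxAl mxE [X in _ + X]mxE dE.
have -> : (B *m (\col_j pos_coord B y j)) i 0 =
    \sum_j pos_coord B y j * (d *m B) 0 j.
  by rewrite mxE; apply: eq_bigr => j _; rewrite dE mxE mulrC.
rewrite /f; lra.
Qed.

(** * Recession directions of the feasible sets *)

Lemma bounded_recession (R : realType) (V : normedModType R) (S : set V)
    (v d : V) :
  bounded_set S -> (forall t : R, 0 <= t -> S (v + t *: d)) -> d = 0.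
Proof.
move=> [M0 [_ /(_ (M0 + 1))]]; rewrite ltrDl ltr01 => /(_ isT) SM vS.
apply/eqP; rewrite -normr_le0 leNgt; apply/negP => d0.
(* At t = (K + 1) / |d| the ray has left the ball of radius M0 + 1. *)
pose K := M0 + 1 + `|v|.
have K0 : 0 <= K.
  have := SM _ (vS 0 (lexx _)); rewrite scale0r addr0 /= /K.
  have := normr_ge0 v; lra.
have t0 : 0 <= (K + 1) / `|d| by rewrite divr_ge0// addr_ge0.
have := SM _ (vS _ t0); rewrite /= => h.
have := ler_normB (v + ((K + 1) / `|d|) *: d) v.
rewrite addrAC subrr add0r normrZ normrM normfV normr_id -mulrA mulVf ?gt_eqF//.
rewrite mulr1 (ger0_norm (addr_ge0 K0 ler01)) /K in h *; lra.
Qed.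

(** Encodes A x = 0, x >= 0 as a system of inequalities on the row [x^T]; the
right-hand side t in the next lemma then relaxes it to |A x| <= t, x >= - t,
which covers every primal feasible set whose right-hand side is bounded by
t. *)
Definition nonneg_kernel_mx (R : realType) m n (A : 'M[R]_(m, n)) :
    'M[R]_(n, m + m + n) :=
  row_mx (row_mx A^T (- A^T)) (- 1%:M).

Lemma nonneg_kernel_mxP (R : realType) m n (A : 'M[R]_(m, n)) (x : 'cV[R]_n)
    (t : R) :
  (forall j, (x^T *m nonneg_kernel_mx A) 0 j <= t) <->
  (forall i, `|(A *m x) i 0| <= t) /\ (forall i, - t <= x i 0).
Proof.
have Ax i : (x^T *m A^T) 0 i = (A *m x) i 0 by rewrite -trmx_mul mxE.
rewrite /nonneg_kernel_mx !mul_mx_row !mulmxN mulmx1; split=> [xt|[At xt] j].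
  split=> i; last first.
    by have := xt (rshift _ i); rewrite row_mxEr !mxE lerNl.
  have := xt (lshift _ (lshift _ i)); rewrite !row_mxEl Ax => le_t.
  have := xt (lshift _ (rshift _ i)); rewrite row_mxEl row_mxEr mxE Ax lerNl.
  by rewrite ler_norml le_t andbT.
case: (split_ordP j) => k -> {j}; last by rewrite row_mxEr !mxE lerNl.
rewrite row_mxEl; case: (split_ordP k) => i -> {k}.
  by rewrite row_mxEl Ax ler_normlW.
by rewrite row_mxEr mxE Ax lerNl; have := At i; rewrite ler_norml => /andP[].
Qed.

Lemma primal_bounded_trivial_cone (R : realType) m n (A : 'M[R]_(m, n)) bhat b :
  primal_feasible A bhat b !=set0 -> bounded_set (primal_feasible A bhat b) ->
  trivial_cone (nonneg_kernel_mx A).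
Proof.
move=> [x0 [Ax0 x0_ge0]] bd x; rewrite -(trmxK x) => /nonneg_kernel_mxP[Ax x_ge0].
rewrite (_ : x^T = 0) ?trmx0//; apply: (bounded_recession (v := x0) bd) => t t0.
have Ax0' : A *m x^T = 0.
  by apply/colP => i; have := Ax i; rewrite normr_le0 => /eqP ->; rewrite mxE.
split; first by rewrite mulmxDr -scalemxAr Ax0' scaler0 addr0.
by move=> i; rewrite mxE addr_ge0// mxE mulr_ge0// -oppr0.
Qed.

Lemma dual_bounded_trivial_cone (R : realType) m n (A : 'M[R]_(m, n)) chat c :
  dual_feasible A chat c !=set0 -> bounded_set (dual_feasible A chat c) ->
  trivial_cone A.
Proof.
move=> [[y0 s0] [/= Ay0 s0_ge0]] bd y yA.
suff /(congr1 fst)/= : (y^T, - (y *m A)^T) = 0 :> ('cV[R]_m * 'cV[R]_n).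
  by move=> /(congr1 trmx); rewrite trmxK trmx0.
apply: (bounded_recession (v := (y0, s0)) bd) => t t0; split=> /=.
  rewrite mulmxDr -scalemxAr -trmx_mul addrACA -scalerDr.
  by rewrite subrr scaler0 addr0.
move=> i; rewrite mxE addr_ge0// mxE mulr_ge0//.
by rewrite mxE mxE oppr_ge0.
Qed.

(** * Uniform bounds on the optimal values *)

Lemma weak_duality (R : realType) m n (A : 'M[R]_(m, n)) bhat chat b c x ys :
  primal_feasible A bhat b x -> dual_feasible A chat c ys ->
  (ys.1^T *m (bhat + b)) 0 0 <= ((chat + c)^T *m x) 0 0.
Proof.
move=> [<- x0] [<- s0].
rewrite linearD/= trmx_mul trmxK mulmxDl mulmxA [leRHS]mxE lerDl mxE.
by apply: sumr_ge0 => i _; rewrite mxE mulr_ge0.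
Qed.

Lemma primal_objective_bounded (R : realType) m n (A : 'M[R]_(m, n))
    (bhat : 'cV[R]_m) (chat : 'cV[R]_n) (beta : R) :
  trivial_cone (nonneg_kernel_mx A) -> 0 <= beta ->
  exists M : R, forall (b : 'cV[R]_m) (c : 'cV[R]_n) x,
    (forall i, `|(bhat + b) i 0| <= beta) ->
    (forall i, `|(chat + c) i 0| <= beta) -> primal_feasible A bhat b x ->
    `|((chat + c)^T *m x) 0 0| <= M.
Proof.
move=> triv beta0; have [M xM] := trivial_cone_bounded triv beta0.
exists (n%:R * (beta * M)) => b c x bb cb [Axb x0].
apply: norm_dot_le => i; first by rewrite mxE.
have /xM xTM : forall j, (x^T *m nonneg_kernel_mx A) 0 j <= beta.
  apply/nonneg_kernel_mxP; rewrite Axb; split=> // j.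
  by rewrite (le_trans _ (x0 j))// oppr_le0.
by have := le_trans (coord_le_norm x^T 0 i) xTM; rewrite mxE.
Qed.

(** Any dual feasible (y, s) satisfies y A <= chat + c, so y is bounded
independently of c, and weak duality turns this into a bound on the primal
objective. *)
Lemma dual_bounded_lower (R : realType) m n (A : 'M[R]_(m, n))
    (bhat : 'cV[R]_m) (chat : 'cV[R]_n) (beta : R) :
  trivial_cone A -> 0 <= beta ->
  exists M : R, forall (b : 'cV[R]_m) (c : 'cV[R]_n) x ys,
    (forall i, `|(bhat + b) i 0| <= beta) ->
    (forall i, `|(chat + c) i 0| <= beta) -> primal_feasible A bhat b x ->
    dual_feasible A chat c ys ->
    - M <= ((chat + c)^T *m x) 0 0.
Proof.
move=> triv beta0; have [M yM] := trivial_cone_bounded triv beta0.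
exists (m%:R * (M * beta)) => b c x ys bb cb Px Dys.
rewrite (le_trans _ (weak_duality Px Dys))// lerNl.
have yTM : `|ys.1^T| <= M.
  apply: yM => j; case: Dys => Dys s0.
  have := congr1 (fun z : 'cV_n => z j 0) Dys.
  rewrite mxE -[X in A^T *m X]trmxK -trmx_mul mxE => yAE.
  rewrite (le_trans _ (le_trans (ler_norm _) (cb j)))//.
  by rewrite -yAE lerDl.
have : `|(ys.1^T *m (bhat + b)) 0 0| <= m%:R * (M * beta).
  by apply: norm_dot_le => // i; rewrite (le_trans (coord_le_norm _ _ _)).
by rewrite ler_norml lerNl => /andP[].
Qed.

Lemma dual_bounded_upper (R : realType) m n (A : 'M[R]_(m, n))
    (bhat : 'cV[R]_m) (chat : 'cV[R]_n) (beta : R) :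
  trivial_cone A -> 0 <= beta ->
  exists M : R, forall (b : 'cV[R]_m) (c : 'cV[R]_n),
    (forall i, `|(bhat + b) i 0| <= beta) ->
    (forall i, `|(chat + c) i 0| <= beta) ->
    exists2 x, primal_feasible A bhat b x & ((chat + c)^T *m x) 0 0 <= M.
Proof.
move=> triv beta0; have [M solM] := trivial_cone_solvable triv beta0.
exists (n%:R * (beta * M)) => b c bb cb; have [x [xM Axb]] := solM _ bb.
exists x; first by split=> // i; have /andP[] := xM i.
apply: ler_normlW; apply: norm_dot_le => i; first by rewrite mxE.
by have /andP[x0 xiM] := xM i; rewrite ger0_norm.
Qed.

(** The point [bc0] matters: over an empty set the supremum and the infimum would
be infinite. *)
Lemma extreme_values_fin_num (R : realType) m n (A : 'M[R]_(m, n)) bhat chat U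
    (bc0 : 'cV[R]_m * 'cV[R]_n) (L M : R) :
  restricted_uncertainty A bhat chat U bc0 ->
  (forall bc x, restricted_uncertainty A bhat chat U bc ->
    primal_feasible A bhat bc.1 x -> L <= ((chat + bc.2)^T *m x) 0 0) ->
  (forall bc, restricted_uncertainty A bhat chat U bc ->
    exists2 x, primal_feasible A bhat bc.1 x &
      ((chat + bc.2)^T *m x) 0 0 <= M) ->
  worst_value A bhat chat U \is a fin_num /\
  best_value A bhat chat U \is a fin_num.
Proof.
move=> U0 lo up.
have vlo bc : restricted_uncertainty A bhat chat U bc ->
    (L%:E <= optimal_value A bhat chat bc.1 bc.2)%E.
  move=> Ubc; apply: le_ereal_inf_tmp => _ [x Px <-]; rewrite lee_fin; exact: lo.
have vup bc : restricted_uncertainty A bhat chat U bc ->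
    (optimal_value A bhat chat bc.1 bc.2 <= M%:E)%E.
  move=> /up[x Px xM]; apply: ge_ereal_inf.
  by exists (((chat + bc.2)^T *m x) 0 0)%:E; [exists x | rewrite lee_fin].
have fin (v : \bar R) : (L%:E <= v)%E -> (v <= M%:E)%E -> v \is a fin_num.
  move=> Lv vM; rewrite fin_numElt (lt_le_trans _ Lv) ?ltNyr//.
  by rewrite (le_lt_trans vM) ?ltry.
split; apply: fin.
- by apply: le_trans (vlo _ U0) _; apply: ereal_sup_ubound; exists bc0.
- by apply: ge_ereal_sup => _ [bc Ubc <-]; exact: vup.
- by apply: le_ereal_inf_tmp => _ [bc Ubc <-]; exact: vlo.
- by apply: le_trans _ (vup _ U0); apply: ereal_inf_lbound; exists bc0.
Qed.

Lemma data_bounded (R : realType) m n (bhat : 'cV[R]_m) (chat : 'cV[R]_n)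
    (U : set ('cV[R]_m * 'cV[R]_n)) :
  compact U -> exists2 beta : R, 0 <= beta & forall bc, U bc ->
    (forall i, `|(bhat + bc.1) i 0| <= beta) /\
    (forall i, `|(chat + bc.2) i 0| <= beta).
Proof.
move=> /compact_bounded[M0 [_ /(_ (`|M0| + 1))]].
rewrite (le_lt_trans (ler_norm _)) ?ltrDl// => /(_ isT) UM.
exists (`|bhat| + `|chat| + (`|M0| + 1)); first by rewrite !addr_ge0.
move=> bc /UM /=; rewrite prod_normE ge_max => /andP[b1 c1].
have := ler_normD bhat bc.1; have := ler_normD chat bc.2.
have := normr_ge0 bhat; have := normr_ge0 chat => h1 h2 h3 h4.
by split=> i; apply: le_trans (coord_le_norm _ _ _) _; lra.
Qed.

Theorem proposition3 (R : realType) (m n : nat) (Ahat : 'M[R]_(m, n))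
    (bhat : 'cV[R]_m) (chat : 'cV[R]_n) (U : set ('cV[R]_m * 'cV[R]_n))
    (U_compact : compact U) (U_convex : convex_set U) (U_zero : U (0, 0))
    (P_nonempty : primal_feasible Ahat bhat 0 !=set0)
    (D_nonempty : dual_feasible Ahat chat 0 !=set0)
    (P_or_D_bounded : bounded_set (primal_feasible Ahat bhat 0) \/
                      bounded_set (dual_feasible Ahat chat 0)) :
  worst_value Ahat bhat chat U \is a fin_num /\
  best_value Ahat bhat chat U \is a fin_num.
Proof.
have [beta beta0 Ubeta] := data_bounded bhat chat U_compact.
have U0 : restricted_uncertainty Ahat bhat chat U (0, 0) by split.
case: P_or_D_bounded => [/(primal_bounded_trivial_cone P_nonempty)|
                         /(dual_bounded_trivial_cone D_nonempty)] triv.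
  have [M PM] := primal_objective_bounded bhat chat triv beta0.
  apply: (extreme_values_fin_num (L := - M) (M := M) U0).
    move=> bc x [/Ubeta[bb cb] _ _] /(PM _ _ _ bb cb).
    by rewrite ler_norml => /andP[].
  move=> bc [/Ubeta[bb cb] [x Px] _]; exists x => //.
  by apply: ler_normlW; exact: PM bb cb Px.
have [L DL] := dual_bounded_lower bhat chat triv beta0.
have [M DM] := dual_bounded_upper bhat chat triv beta0.
apply: (extreme_values_fin_num (L := - L) (M := M) U0).
  by move=> bc x [/Ubeta[bb cb] _ [ys Dys]] Px; exact: DL bb cb Px Dys.
by move=> bc [/Ubeta[bb cb] _ _]; exact: DM.
Qed.
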